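(* For every $n\ge 2$ the genus distribution of ${\cal S}_{11}^n$ is unimodal, and its peak $p_{11}(n)$ is $$p_{11}(n)=\begin{cases}\Big[\dfrac{n}{2}\Big]+1, & 2\le n\le 5,\\[2mm] \Big[\dfrac{n+1}{3}\Big]+2, & 6\le n\le 16,\\[2mm] \Big[\dfrac{n+2}{3}\Big]+2, & n\ge 17.\end{cases}$$
   Context: $[x]$ denotes the largest integer not exceeding $x$. A surface is represented by a cyclic word in which every occurring letter $x$ appears exactly once as $x$ and exactly once as $x^-$; it is the closed orientable surface obtained from a polygon with boundary labelled by the word by identifying each side $x$ with the side $x^-$ (orientation reversed), and its genus is the genus of that surface. Let $a,b,c,a_1,a_2,\dots$ be distinct letters. For $n\ge 1$ and subsets $K,T\subseteq\{1,\dots,n\}$ put: $R_1^n$ = product of the letters $a_k$, $k\in K$, in decreasing order of index; $R_2^n$ = product of the $a_k$, $k\notin K$, in increasing order of index; $R_3^n$ = product of the $a_t^-$, $t\in T$, in decreasing order of index; $R_4^n$ = product of the $a_t^-$, $t\notin T$, in increasing order of index. The set of ladder surfaces considered is ${\cal S}_{11}^n=\{R_1^naR_2^na^-bR_3^nb^-cR_4^nc^-\}$, where $(K,T)$ runs over all $4^n$ pairs of subsets and surfaces are counted with multiplicity (one for each pair). The genus distribution of ${\cal S}_{11}^n$ is the sequence $(g_{i_{11}}(n))_i$, where $g_{i_{11}}(n)$ is the number of surfaces of genus $i$ in ${\cal S}_{11}^n$ and $i$ runs from the minimum to the maximum genus. A finite sequence of nonnegative numbers $\{a_i\}_{i=q}^n$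 is unimodal if $a_q\le\cdots\le a_{l-1}<a_l=\cdots=a_m>a_{m+1}\ge\cdots\ge a_n$ for some $q\le l\le m\le n$; if $l=m$, then $m$ is called the peak (indices are genera). *)

(* Defs.v *)
From HB Require Import structures.
From mathcomp Require Export all_boot.

Set Implicit Arguments.
Unset Strict Implicit.
Unset Printing Implicit Defensive.

(** ** Surfaces represented by cyclic words *)

Section Words.
Variable L : eqType.

(* [(x, false)] stands for the side x, and [(x, true)] for the side x^-. *)
Definition side : Type := (L * bool)%type.

Definition inv_side (s : side) : side := (s.1, ~~ s.2).

Definition is_surface (w : seq side) : bool :=
  all (fun s => (count_mem s w == 1) && (count_mem (inv_side s) w == 1)) w.

(* Corner i of the polygon is the initial point of its side i, whose terminal
   point is corner [ordS i].  The sides x and x^- are glued with the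
   orientation reversed: initial point to terminal point. *)
Definition glued_corners (w : seq side) : rel 'I_(size w) := fun u v =>
  [exists i, exists j,
    (tnth (in_tuple w) j == inv_side (tnth (in_tuple w) i)) &&
    (((u == i) && (v == ordS j)) || ((u == ordS i) && (v == j)))].

Definition nb_vertices (w : seq side) : nat :=
  n_comp (@glued_corners w) predT.

Definition nb_edges (w : seq side) : nat := size (undup (map fst w)).

(* The glued polygon has a single face, so that
   2 - 2 * genus = nb_vertices - nb_edges + 1. *)
Definition genus (w : seq side) : nat :=
  ((nb_edges w).+1 - nb_vertices w)./2.

End Words.

(** ** Ladder surfaces *)

Inductive letter : Type := La | Lb | Lc | Lai of nat.

Definition letter_code (x : letter) : nat :=
  match x with La => 0 | Lb => 1 | Lc => 2 | Lai k => k.+3 end.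

Definition letter_decode (k : nat) : letter :=
  match k with 0 => La | 1 => Lb | 2 => Lc | k'.+3 => Lai k' end.

Lemma letter_codeK : cancel letter_code letter_decode.
Proof. by case. Qed.

HB.instance Definition _ := Equality.copy letter (can_type letter_codeK).

Definition pos (x : letter) : side letter := (x, false).
Definition neg (x : letter) : side letter := (x, true).

Section Ladder.
Variable n : nat.
Implicit Types K T : {set 'I_n}.

(* The index set {1, ..., n} is represented by 'I_n, with k standing for k + 1;
   [enum K] lists K in increasing order. *)
Definition ai (k : 'I_n) : letter := Lai k.+1.

Definition R1 K : seq (side letter) := [seq pos (ai k) | k <- rev (enum K)].
Definition R2 K : seq (side letter) := [seq pos (ai k) | k <- enum (~: K)].
Definition R3 T : seq (side letter) := [seq neg (ai t) | t <- rev (enum T)].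
Definition R4 T : seq (side letter) := [seq neg (ai t) | t <- enum (~: T)].

Definition ladder11 (KT : {set 'I_n} * {set 'I_n}) : seq (side letter) :=
  R1 KT.1 ++ [:: pos La] ++ R2 KT.1 ++ [:: neg La; pos Lb] ++
  R3 KT.2 ++ [:: neg Lb; pos Lc] ++ R4 KT.2 ++ [:: neg Lc].

Definition genus_count11 (i : nat) : nat :=
  #|[set KT : {set 'I_n} * {set 'I_n} | genus (ladder11 KT) == i]|.

Definition min_genus11 : nat :=
  genus (ladder11 [arg min_(KT < (set0, set0)) genus (ladder11 KT)]).

Definition max_genus11 : nat :=
  \max_(KT : {set 'I_n} * {set 'I_n}) genus (ladder11 KT).

Lemma ai_inj : injective ai.
Proof. by move=> i j [] /val_inj. Qed.

Lemma ladder11_is_surface KT : is_surface (ladder11 KT).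
Proof.
suff H s : s \in ladder11 KT ->
    (count_mem s (ladder11 KT) == 1)
    && (count_mem (inv_side s) (ladder11 KT) == 1) by exact/allP.
have pos_inj : injective (fun k => pos (ai k)) by move=> i j [] /val_inj.
have neg_inj : injective (fun k => neg (ai k)) by move=> i j [] /val_inj.
have cnt (f : 'I_n -> side letter) (A : {set 'I_n}) k : injective f ->
    (count_mem (f k) [seq f i | i <- rev (enum A)] = (k \in A)) *
    (count_mem (f k) [seq f i | i <- enum A] = (k \in A)).
  by move=> fI; rewrite map_rev count_rev (count_uniq_mem _ _)
    ?map_inj_uniq ?enum_uniq // mem_map // mem_enum.
have cnt0 (f : 'I_n -> side letter) s' (A : seq 'I_n) : (forall k, f k != s') ->
    count_mem s' [seq f i | i <- A] = 0.
  by move=> fs; elim: A => //= x A ->; rewrite (negbTE (fs x)).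
have posNneg x y : pos x != neg y by rewrite xpair_eqE andbF.
have negNpos x y : neg x != pos y by rewrite xpair_eqE andbF.
have inside k b : count_mem (ai k, b) (ladder11 KT) = 1.
  rewrite /ladder11 !count_cat /R1 /R2 /R3 /R4.
  case: b; [rewrite -/(neg (ai k)) | rewrite -/(pos (ai k))].
    do 2![rewrite (cnt0 (fun k => pos (ai k))); last by move=> i].
    by rewrite !(cnt _ _ k neg_inj) inE; case: (k \in KT.2).
  do 2![rewrite (cnt0 (fun k => neg (ai k))); last by move=> i].
  by rewrite !(cnt _ _ k pos_inj) inE; case: (k \in KT.1).
have outside x b : x \in [:: La; Lb; Lc] -> count_mem (x, b) (ladder11 KT) = 1.
  move=> xo; rewrite /ladder11 !count_cat /R1 /R2 /R3 /R4.
  have aiNx k : ai k != x.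
    by apply: contraL xo => /eqP<-; rewrite !inE.
  have N c k : (ai k, c) != (x, b) by rewrite xpair_eqE negb_and aiNx.
  do 2![rewrite (cnt0 (fun k => pos (ai k))); last by move=> i; exact: N].
  do 2![rewrite (cnt0 (fun k => neg (ai k))); last by move=> i; exact: N].
  by move: xo; rewrite !inE => /or3P[]/eqP->; case: b {N}.
case: s => x b xin; rewrite /inv_side /=.
suff: (x \in [:: La; Lb; Lc]) \/ exists k, x = ai k.
  by case=> [xo | [k ->]]; [rewrite !outside | rewrite !inside].
case: x xin => [||| m]; [by left | by left | by left |] => xin; right.
move: xin; rewrite /ladder11 !mem_cat !inE !xpair_eqE !orbF /=.
by repeat case/orP; case/mapP=> k _ [-> _]; exists k.
Qed.

End Ladder.

(** ** Unimodality *)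

(* The pattern
   f q <= ... <= f (l-1) < f l = ... = f m > f (m+1) >= ... >= f r. *)
Definition unimodal_at (f : nat -> nat) (q r l m : nat) : Prop :=
  [/\ q <= l <= m /\ m <= r,
      forall i, q <= i -> i.+1 < l -> f i <= f i.+1,
      forall i, q <= i -> i.+1 = l -> f i < f l,
      forall i, l <= i <= m -> f i = f m &
      (m < r -> f m.+1 < f m) /\
      (forall i, m < i < r -> f i.+1 <= f i)].

Definition unimodal (f : nat -> nat) (q r : nat) : Prop :=
  exists l m, unimodal_at f q r l m.

Definition is_peak (f : nat -> nat) (q r p : nat) : Prop :=
  unimodal_at f q r p p.

Definition p11 (n : nat) : nat :=
  if n <= 5 then n %/ 2 + 1
  else if n <= 16 then (n + 1) %/ 3 + 2
  else (n + 2) %/ 3 + 2.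

(* Main.v *)
Require Import Defs.
From Stdlib Require BinNat.
From mathcomp Require Import all_algebra zify ring.

Set Implicit Arguments.
Unset Strict Implicit.
Unset Printing Implicit Defensive.

Import GRing.Theory Num.Theory.

(* If V is the number of vertices, 2^V counts the 2-colourings of the corners
   compatible with the gluing.  Colouring the two end points of every letter,
   this is the number of ways to follow R1, ..., R4 as four closed walks, and
   the letters can be summed out one at a time from the outside of the ladder.
   Only 24 boundary conditions appear, so the genus distribution is read off a
   24-state automaton, whose generating polynomials can be solved explicitly.
   With L(m, i) = m / (m - i) * C(m - i, i) and k_i = 8^i L(m, i), the number of
   surfaces of genus i + 2 with m letters a_k is
     2^(m - 2i) k_i + k_(i+1) - k_i + (a term supported near i = 0 and i = m/2).
   The ratio of consecutive k_i is rational in i, and the difference of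
   consecutive counts changes sign at the claimed peak: for m >= 42 by
   estimates, for m < 42 by computation. *)

(** * Colourings *)

(** A colouring constant along [e] amounts to the set of component roots coloured [true], and every
    set of roots arises. *)
Lemma card_constant_colourings (T : finType) (e : rel T) : connect_sym e ->
  #|[set f : {ffun T -> bool} | [forall x, forall y, e x y ==> (f x == f y)]]|
    = 2 ^ n_comp e predT.
Proof.
move=> se; have -> : n_comp e predT = #|[set x | roots e x]|.
  by rewrite cardsE; apply: eq_card => x; rewrite !inE andbT.
rewrite -card_powerset.
pose h (A : {set T}) := [ffun x => fingraph.root e x \in A].
have hinj : {in powerset [set x | roots e x] &, injective h}.
  move=> A B; rewrite !inE => /subsetP sA /subsetP sB /ffunP eAB.
  apply/setP => x; case rx: (roots e x).
    by have := eAB x; rewrite !ffunE (eqP rx).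
  by apply/idP/idP => [/sA|/sB]; rewrite inE rx.
rewrite -(card_in_imset hinj); apply: eq_card => f; rewrite inE.
apply/forallP/imsetP => [cf | [A _ ->] x].
  exists [set x | roots e x && f x].
    by rewrite inE; apply/subsetP => x; rewrite !inE => /andP[].
  apply/ffunP => x; rewrite ffunE inE roots_root //=.
  have /connectP[p ep ->] := connect_root e x.
  elim: p x ep => //= y p IH x /andP[exy /IH <-].
  by have /forallP/(_ y) := cf x; rewrite exy => /eqP.
apply/forallP => y; apply/implyP => /connect1 exy; rewrite !ffunE.
by have /eqP -> : fingraph.root e x == fingraph.root e y by rewrite root_connect.
Qed.

Section Labellings.
Variable L : eqType.
Implicit Types (w : seq (side L)) (F : side L -> bool).

(* [F s] is the colour of the initial point of the side s; as s and s^- are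
   glued with reversed orientation, [F (inv_side s)] is that of its end. *)
Fixpoint walk F (p : bool) w (q : bool) : bool :=
  if w is s :: w' then (F s == p) && walk F (F (inv_side s)) w' q else p == q.

Lemma walk_rcons F p w s q :
  walk F p (rcons w s) q = walk F p w (F s) && (F (inv_side s) == q).
Proof. by elim: w p => [|t w IH] p /=; rewrite ?IH ?andbA // eq_sym. Qed.

Lemma walk_cat_cons F p w1 s w2 q :
  walk F p (w1 ++ s :: w2) q =
    walk F p w1 (F s) && walk F (F (inv_side s)) w2 q.
Proof. by elim: w1 p => [|t w IH] p /=; rewrite ?IH ?andbA // eq_sym. Qed.

Lemma inv_sideK : involutive (@inv_side L).
Proof. by case=> x b; rewrite /inv_side negbK. Qed.

Lemma cycle_walk F s w :
  cycle (fun t u => F u == F (inv_side t)) (s :: w) = walk F (F s) (s :: w) (F s).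
Proof.
rewrite /= eqxx /=; set e := fun t u => _.
have H q t p : path e t p && (F (inv_side (last t p)) == q) =
               walk F (F (inv_side t)) p q.
  by elim: p t => //= u p IH t; rewrite -andbA IH.
by rewrite rcons_path -H /e eq_sym.
Qed.

Lemma cycle_nthP (T : Type) (x0 : T) (e : rel T) x p :
  reflect (forall i, i < (size p).+1 ->
             e (nth x0 (x :: p) i) (nth x0 (x :: p) (i.+1 %% (size p).+1)))
          (cycle e (x :: p)).
Proof.
apply: (iffP (pathP x0)) => H i; rewrite ?size_rcons => lti; have := H i;
  rewrite ?size_rcons => /(_ lti); rewrite -rcons_cons nth_rcons /= lti nth_rcons;
  (move: lti; rewrite ltnS leq_eqVlt => /predU1P[->|lti];
    [by rewrite ltnn eqxx modnn | by rewrite lti modn_small]).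
Qed.

Lemma uniq_surface w : is_surface w -> uniq w.
Proof.
move/allP => sw; apply: count_mem_uniq => s.
case sin: (s \in w); first by have /andP[/eqP -> _] := sw s sin.
by apply/count_memPn; rewrite sin.
Qed.

Lemma glued_corners_sym w : symmetric (@glued_corners L w).
Proof.
move=> u v; apply/existsP/existsP => -[i /existsP[j /andP[/eqP eij uv]]];
  exists j; apply/existsP; exists i; rewrite eij inv_sideK eqxx /=;
  by case/orP: uv => /andP[-> ->]; rewrite ?orbT.
Qed.

(** Gluing a side to its mate identifies the end of the one with the start of the other. So a
    colouring respects the gluing exactly when, around the polygon, each side starts with the colour
    at which the preceding side ends; [d] parametrises such colourings faithfully. *)
Lemma card_labellings (D : finType) (lab : D -> side L -> bool) w :
  is_surface w -> w != [::] ->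
  (forall d d', {in w, lab d =1 lab d'} -> d = d') ->
  (forall F, cycle (fun s t => F t == F (inv_side s)) w ->
     exists d, {in w, lab d =1 F}) ->
  #|[set d | cycle (fun s t => lab d t == lab d (inv_side s)) w]|
    = 2 ^ nb_vertices w.
Proof.
move=> sw wn0 labI labS.
rewrite -card_constant_colourings; last exact/sym_connect_sym/glued_corners_sym.
pose h d := [ffun i => lab d (tnth (in_tuple w) i)].
have uw := uniq_surface sw.
have invw s : s \in w -> inv_side s \in w.
  by move/(allP sw)/andP => [_ /eqP c]; rewrite -has_pred1 has_count c.
have hI : injective h.
  move=> d d' /ffunP e; apply: labI => s /(nthP s)[i lti <-].
  by have := e (Ordinal lti); rewrite !ffunE !(tnth_nth s).
have key F : reflect (forall i j : 'I_(size w),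
      tnth (in_tuple w) j = inv_side (tnth (in_tuple w) i) ->
      F (tnth (in_tuple w) (ordS i)) = F (tnth (in_tuple w) j))
    (cycle (fun s t => F t == F (inv_side s)) w).
  case: w sw wn0 labI labS h uw invw hI => // x p sw _ _ _ _ uw invw _.
  apply: (iffP (cycle_nthP x _ x p)) => H.
    move=> i j eij; have /eqP := H i (ltn_ord i).
    by rewrite eij !(tnth_nth x) /= => ->.
  move=> i lti; apply/eqP; set s := nth x _ i.
  have /(nthP x)[j ltj ej] : inv_side s \in x :: p.
    by apply: invw; rewrite mem_nth.
  by have := H (Ordinal lti) (Ordinal ltj); rewrite !(tnth_nth x) /= -/s ej; apply.
rewrite -(card_imset _ hI); apply: eq_card => f; rewrite inE.
apply/imsetP/forallP => [[d] | cf].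
  rewrite inE => /key kd -> u; apply/forallP => v; apply/implyP.
  case/existsP => i /existsP[j /andP[/eqP eij /orP[]/andP[/eqP-> /eqP->]]];
    rewrite !ffunE; last by rewrite (kd _ _ eij).
  by rewrite (kd j i) // eij inv_sideK.
have cfP u v : glued_corners u v -> f u = f v.
  by move=> uv; have /forallP/(_ v) := cf u; rewrite uv => /eqP.
have x0 : side L by case: (w) wn0.
(* The value off [w] is arbitrary; on [w], uniqueness lets [index] recover the corner. *)
pose F s := if insub (index s w) is Some i then f i else false.
have Fnth i : F (tnth (in_tuple w) i) = f i.
  by rewrite /F (tnth_nth x0) index_uniq // valK.
have [d dF] : exists d, {in w, lab d =1 F}.
  apply: labS; apply/key => i j eij; rewrite !Fnth; apply: cfP.
  apply/existsP; exists i; apply/existsP; exists j.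
  by rewrite eij !eqxx orbT.
exists d; last by apply/ffunP => i; rewrite ffunE dF ?Fnth ?mem_tnth.
rewrite inE; apply/key => i j eij; rewrite !dF ?mem_tnth // !Fnth.
apply: cfP; apply/existsP; exists i; apply/existsP; exists j.
by rewrite eij !eqxx orbT.
Qed.

End Labellings.

(** * Closed walks along a ladder *)

Notation pair2 := (bool * bool)%type.
Notation quad := (bool * bool * bool * bool)%type.

Definition bools : seq bool := [:: true; false].
Definition pairs : seq pair2 := [seq (u, v) | u <- bools, v <- bools].
Definition quads : seq quad :=
  [seq (x, z.1, z.2) | x <- pairs, z <- pairs].

Lemma mem_pairs p : p \in pairs. Proof. by case: p => [[] []]. Qed.
Lemma mem_quads x : x \in quads. Proof. by case: x => [[[[] []] []] []]. Qed.
Lemma uniq_quads : uniq quads. Proof. by []. Qed.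

(** Serves both for lists of letter positions and for lists of end-point colours. *)
Fixpoint words n : seq (seq pair2) :=
  if n is n'.+1 then flatten [seq [seq p :: s | s <- words n'] | p <- pairs]
  else [:: [::]].

Lemma mem_words n s : (s \in words n) = (size s == n).
Proof.
elim: n s => [|n IH] s; first by rewrite inE size_eq0.
apply/flatten_mapP/idP => [[q _ /mapP[t + ->]] | ]; first by rewrite IH.
case: s => // p s; rewrite eqSS -IH => ws.
by exists p; rewrite ?mem_pairs ?map_f.
Qed.

Lemma uniq_words n : uniq (words n).
Proof.
elim: n => // n IH; rewrite [words _]/=.
have U p : uniq [seq p :: s | s <- words n] by rewrite map_inj_uniq // => s t [].
have D (p q : pair2) : p != q ->
    ~~ has (mem [seq p :: s | s <- words n]) [seq q :: s | s <- words n].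
  move=> pq; apply/hasPn => _ /mapP[s _ ->]; apply/mapP => -[t _ [/esym/eqP]].
  by rewrite (negbTE pq).
by rewrite !cat_uniq !has_cat !U !negb_or !D.
Qed.

Lemma perm_words (C : finType) (b : C -> seq pair2) n :
  injective b -> (forall c, size (b c) = n) ->
  (forall s, size s = n -> exists c, b c = s) ->
  perm_eq [seq b c | c <- enum C] (words n).
Proof.
move=> bI bn bS; apply: uniq_perm (uniq_words n) _.
  by rewrite map_inj_uniq ?enum_uniq.
move=> s; rewrite mem_words; apply/mapP/eqP => [[c _ ->] // | /bS[c <-]].
by exists c; rewrite ?mem_enum.
Qed.

Lemma card_words (C : finType) (b : C -> seq pair2) n P :
  injective b -> (forall c, size (b c) = n) ->
  (forall s, size s = n -> exists c, b c = s) ->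
  #|[set c | P (b c)]| = count P (words n).
Proof.
move=> bI bn bS; rewrite -(permP (perm_words bI bn bS)) count_map.
rewrite -sum1_card -sum1_count big_enum_cond.
by apply: eq_bigl => c; rewrite /= inE.
Qed.

(* A letter z is described by a pair (a, b) of booleans recording whether z
   lies in R1 (otherwise in R2) and z^- in R3 (otherwise in R4); the colours of
   its two end points are (u, v).  Four walks, along R1, ..., R4, have colours
   y at their outer ends; removing the outermost letter z moves these ends. *)
Definition compat (ab uv : pair2) (y : quad) : bool :=
  let: (a, b) := ab in let: (u, v) := uv in let: (y1, y2, y3, y4) := y in
  (if a then y1 == u else y2 == v) && (if b then y3 == v else y4 == u).

Definition inward (ab uv : pair2) (y : quad) : quad :=
  let: (a, b) := ab in let: (u, v) := uv in let: (y1, y2, y3, y4) := y in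
  (if a then v else y1, if a then y2 else u,
   if b then u else y3, if b then y4 else v).

Fixpoint walks (x : quad) (s cs : seq pair2) (y : quad) : bool :=
  match s, cs with
  | ab :: s', uv :: cs' => compat ab uv y && walks x s' cs' (inward ab uv y)
  | [::], [::] => x == y
  | _, _ => false
  end.

Section LadderColourings.
Variable n : nat.
Implicit Types (K T : {set 'I_n}) (c : {ffun 'I_n -> pair2}) (l : seq 'I_n).

(** Closing up the word forces the initial points of a, b and c to share a colour, [x1]; [x2], [x3],
    [x4] colour their terminal points. Letters that do not occur get [false]. *)
Definition lab (d : quad * {ffun 'I_n -> pair2}) (s : side letter) : bool :=
  let: (x1, x2, x3, x4, c) := d in
  match s with
  | (La, b) => if b then x2 else x1
  | (Lb, b) => if b then x3 else x1
  | (Lc, b) => if b then x4 else x1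
  | (Lai 0, _) => false
  | (Lai k.+1, b) => if insub k is Some i then
                       (if b then (c i).2 else (c i).1) else false
  end.

Lemma lab_ai x c k b : lab (x, c) (ai k, b) = if b then (c k).2 else (c k).1.
Proof. by case: x => [[[x1 x2] x3] x4]; rewrite /= valK. Qed.

(** R1 and R3 run inwards, R2 and R4 outwards, so the outermost letter is a first side in the former
    and a last side in the latter. *)
Lemma walks_ladder K T x c l y :
  walks x [seq (k \in K, k \in T) | k <- l] [seq c k | k <- l] y =
  let: (x1, x2, x3, x4) := x in let: (y1, y2, y3, y4) := y in
  [&& walk (lab (x, c)) y1 [seq pos (ai k) | k <- l & k \in K] x1,
      walk (lab (x, c)) x2 [seq pos (ai k) | k <- rev l & k \notin K] y2,
      walk (lab (x, c)) y3 [seq neg (ai k) | k <- l & k \in T] x3 &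
      walk (lab (x, c)) x4 [seq neg (ai k) | k <- rev l & k \notin T] y4].
Proof.
case: x => [[[x1 x2] x3] x4]; set F := lab _.
elim: l y => [|k l IH] [[[y1 y2] y3] y4] /=.
  rewrite !xpair_eqE (eq_sym x1) (eq_sym x3); by do 4!case: (_ == _).
have Fp : F (pos (ai k)) = (c k).1 by exact: lab_ai.
have Fn : F (neg (ai k)) = (c k).2 by exact: lab_ai.
have ip : inv_side (pos (ai k)) = neg (ai k) by [].
have in_ : inv_side (neg (ai k)) = pos (ai k) by [].
rewrite {}IH rev_cons !filter_rcons; case: (c k) Fp Fn => u v /= Fp Fn.
case: (k \in K); case: (k \in T);
  rewrite /= ?map_rcons ?walk_rcons /= ?ip ?in_ ?Fp ?Fn ?(eq_sym u) ?(eq_sym v);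
  by do 6!case: (walk _ _ _ _) || case: (_ == _).
Qed.

Lemma rev_enum_filter (A : {set 'I_n}) :
  rev (enum A) = [seq k <- rev (enum 'I_n) | k \in A].
Proof. by rewrite filter_rev enumT. Qed.

Lemma enumC_filter (A : {set 'I_n}) :
  enum (~: A) = [seq k <- rev (rev (enum 'I_n)) | k \notin A].
Proof.
by rewrite revK [RHS]/= enumT; apply: eq_filter => k; rewrite /= inE.
Qed.

Definition bits (KT : {set 'I_n} * {set 'I_n}) : seq pair2 :=
  [seq (k \in KT.1, k \in KT.2) | k <- rev (enum 'I_n)].

(** R2, R3, R4 are enclosed by a letter and its inverse, hence closed at its terminal point; the
    junctions after a^-, b^- and c^- make the initial points of a, b, c agree and close R1. *)
Lemma ladder_closed F (KT : {set 'I_n} * {set 'I_n}) :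
  cycle (fun s t => F t == F (inv_side s)) (ladder11 KT) =
  [&& F (pos Lb) == F (pos La), F (pos Lc) == F (pos La),
      walk F (F (pos La)) (R1 KT.1) (F (pos La)),
      walk F (F (neg La)) (R2 KT.1) (F (neg La)),
      walk F (F (neg Lb)) (R3 KT.2) (F (neg Lb)) &
      walk F (F (neg Lc)) (R4 KT.2) (F (neg Lc))].
Proof.
set r1 := R1 _; set r2 := R2 _; set r3 := R3 _; set r4 := R4 _.
have -> : ladder11 KT = rcons (r1 ++ pos La :: r2 ++ neg La :: pos Lb :: r3 ++
    neg Lb :: pos Lc :: r4) (neg Lc).
  by rewrite /ladder11 -cats1; do 9?rewrite -?catA /=.
(* Reading the word from c^- places R1 between two fixed letters. *)
rewrite -(rotr_cycle 1) rotr1_rcons cycle_walk /= eqxx /=.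
do 4?rewrite ?walk_cat_cons /=.
rewrite /inv_side /=.
rewrite -!/(pos _) -!/(neg _).
case: (F (pos La)); case: (F (pos Lb)); case: (F (pos Lc));
by rewrite /= ?andbF ?andbT ?eqxx //= ?andbA.
Qed.

Lemma mem_ladder11 (KT : {set 'I_n} * {set 'I_n}) x b :
  (x \in [:: La; Lb; Lc]) || [exists k : 'I_n, x == ai k] ->
  (x, b) \in ladder11 KT.
Proof.
rewrite /ladder11 !mem_cat !inE !xpair_eqE.
case/orP => [/or3P[]/eqP->|/existsP[k /eqP->]]; case: b; rewrite ?orbT //.
  have [kT|kT] := boolP (k \in KT.2).
    by rewrite (_ : _ \in R3 _) ?orbT // map_f // mem_rev mem_enum.
  by rewrite (_ : _ \in R4 _) ?orbT // map_f // mem_enum inE.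
have [kT|kT] := boolP (k \in KT.1).
  by rewrite (_ : _ \in R1 _) ?orbT // map_f // mem_rev mem_enum.
by rewrite (_ : _ \in R2 _) ?orbT // map_f // mem_enum inE.
Qed.

Lemma letters_ladder11 (KT : {set 'I_n} * {set 'I_n}) s :
  s \in ladder11 KT ->
  (s.1 \in [:: La; Lb; Lc]) || [exists k : 'I_n, s.1 == ai k].
Proof.
rewrite /ladder11 !mem_cat !inE.
by repeat case/orP; do ?[move/eqP-> => //];
  case/mapP=> k _ ->; apply/orP; right; apply/existsP; exists k; rewrite eqxx.
Qed.

Lemma nb_edges_ladder11 (KT : {set 'I_n} * {set 'I_n}) :
  nb_edges (ladder11 KT) = n + 3.
Proof.
have -> : n + 3 = size ([:: La; Lb; Lc] ++ [seq ai k | k <- enum 'I_n]).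
  by rewrite size_cat size_map size_enum_ord addnC.
apply/perm_size/uniq_perm; first exact: undup_uniq.
  rewrite cat_uniq map_inj_uniq ?enum_uniq ?andbT /=; last exact: ai_inj.
  by apply/hasPn => _ /mapP[k _ ->].
move=> x; rewrite mem_undup mem_cat.
have -> : (x \in [seq ai k | k <- enum 'I_n]) = [exists k : 'I_n, x == ai k].
  apply/mapP/existsP => [[k _ ->] | [k /eqP ->]]; exists k => //.
  by rewrite mem_enum.
apply/mapP/idP => [[s /letters_ladder11 + ->] // | xl].
by exists (x, true); rewrite ?mem_ladder11.
Qed.

Lemma card_ladder_colourings (KT : {set 'I_n} * {set 'I_n}) :
  2 ^ nb_vertices (ladder11 KT) =
  \sum_(x <- quads) count (fun cs => walks x (bits KT) cs x) (words n).
Proof.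
rewrite -(@card_labellings _ (quad * {ffun 'I_n -> pair2})%type lab).
- have -> : [set d | cycle (fun s t => lab d t == lab d (inv_side s))
                       (ladder11 KT)] =
    [set d : quad * {ffun 'I_n -> pair2} |
       walks d.1 (bits KT) [seq d.2 k | k <- rev (enum 'I_n)] d.1].
    apply/setP => -[[[[x1 x2] x3] x4] c]; rewrite !inE ladder_closed /bits.
    rewrite walks_ladder /= !eqxx /= /R1 /R2 /R3 /R4 !rev_enum_filter.
    by rewrite !enumC_filter.
  pose ws x c := walks x (bits KT) [seq c k | k <- rev (enum 'I_n)] x.
  rewrite -sum1_card (eq_bigl (fun d => ws d.1 d.2)); last first.
    by move=> d; rewrite inE.
  rewrite -(pair_big_dep xpredT ws (fun _ _ => 1)) /=.
  rewrite -big_enum /= (perm_big quads); last first.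
    by apply: uniq_perm => [||x]; rewrite ?enum_uniq // mem_enum mem_quads.
  apply: eq_bigr => x _; rewrite sum1_card -(@card_words
    {ffun 'I_n -> pair2} (fun c => [seq c k | k <- rev (enum 'I_n)]) n
    (fun cs => walks x (bits KT) cs x)).
  + by apply: eq_card => c; rewrite !inE.
  + move=> c c' /eq_in_map ecc; apply/ffunP => k.
    by apply: ecc; rewrite mem_rev mem_enum.
  + by move=> c; rewrite size_map size_rev size_enum_ord.
  move=> s sn; exists [ffun k => nth (true, true) s (index k (rev (enum 'I_n)))].
  apply: (@eq_from_nth _ (true, true)); rewrite size_map size_rev size_enum_ord //.
  move=> i lti; have lti' : i < size (rev (enum 'I_n)).
    by rewrite size_rev size_enum_ord.
  rewrite (nth_map (Ordinal lti)) // ffunE index_uniq //.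
  by rewrite rev_uniq enum_uniq.
- exact: ladder11_is_surface.
- by rewrite -size_eq0 /ladder11 !size_cat !addnS.
- move=> [[[[x1 x2] x3] x4] c] [[[[y1 y2] y3] y4] c'] e.
  have E b x : (x \in [:: La; Lb; Lc]) -> lab (x1, x2, x3, x4, c) (x, b) =
      lab (y1, y2, y3, y4, c') (x, b).
    by move=> xl; apply: e; rewrite mem_ladder11 ?xl.
  have [E1 E2 E3 E4] := And4 (E false La isT) (E true La isT) (E true Lb isT)
     (E true Lc isT).
  rewrite /= in E1 E2 E3 E4; rewrite E1 E2 E3 E4; congr (_, _).
  apply/ffunP => k; have E' b := e (ai k, b).
  have /= := E' true; have /= := E' false; rewrite !valK.
  have kl b : (ai k, b) \in ladder11 KT.
    by apply: mem_ladder11; apply/orP; right; apply/existsP; exists k.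
  by case: (c k) (c' k) => u v [u' v'] /= /(_ (kl _)) -> /(_ (kl _)) ->.
move=> F; rewrite ladder_closed => /andP[/eqP Fb /andP[/eqP Fc _]].
exists (F (pos La), F (neg La), F (neg Lb), F (neg Lc),
  [ffun k => (F (pos (ai k)), F (neg (ai k)))]) => -[x b] /letters_ladder11 /=.
case/orP => [|/existsP[k /eqP ->]].
  by rewrite !inE => /or3P[]/eqP->; case: b.
by rewrite [LHS]/= valK ffunE; case: b.
Qed.

End LadderColourings.

(** * The automaton *)

(* Summing over the letters from the outside inwards produces, up to powers of
   2, only indicators of the colourings of the eight end points (0-3 for the
   inner and 4-7 for the outer ends) that are constant on the four chords of a
   pairing of these points; 24 pairings occur, the initial one being number 0,
   which closes up the four walks. *)
Definition chords : seq (seq (nat * nat)) :=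
 [:: [:: (0, 4); (1, 5); (2, 6); (3, 7)];
    [:: (0, 6); (1, 5); (2, 4); (3, 7)];
    [:: (0, 3); (1, 5); (2, 6); (4, 7)];
    [:: (0, 4); (1, 2); (3, 7); (5, 6)];
    [:: (0, 4); (1, 7); (2, 6); (3, 5)];
    [:: (0, 6); (1, 5); (2, 3); (4, 7)];
    [:: (0, 1); (2, 4); (3, 7); (5, 6)];
    [:: (0, 6); (1, 7); (2, 4); (3, 5)];
    [:: (0, 3); (1, 5); (2, 4); (6, 7)];
    [:: (0, 3); (1, 2); (4, 7); (5, 6)];
    [:: (0, 3); (1, 7); (2, 6); (4, 5)];
    [:: (0, 6); (1, 2); (3, 7); (4, 5)];
    [:: (0, 4); (1, 2); (3, 5); (6, 7)];
    [:: (0, 1); (2, 6); (3, 5); (4, 7)];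
    [:: (0, 4); (1, 7); (2, 3); (5, 6)];
    [:: (0, 4); (1, 5); (2, 3); (6, 7)];
    [:: (0, 1); (2, 3); (4, 7); (5, 6)];
    [:: (0, 6); (1, 7); (2, 3); (4, 5)];
    [:: (0, 1); (2, 6); (3, 7); (4, 5)];
    [:: (0, 1); (2, 4); (3, 5); (6, 7)];
    [:: (0, 6); (1, 2); (3, 5); (4, 7)];
    [:: (0, 3); (1, 7); (2, 4); (5, 6)];
    [:: (0, 3); (1, 2); (4, 5); (6, 7)];
    [:: (0, 1); (2, 3); (4, 5); (6, 7)]].

(** Loops formed by the chords when the inner and outer end of each walk are identified. *)
Definition nb_loops : seq nat :=
  [:: 4; 3; 3; 3; 3; 2; 2; 2; 2; 2; 2; 2; 2; 2; 2; 3; 1; 1; 3; 1; 1; 1; 1; 2].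

(* Row k, indexed by the positions (a, b) of the outermost letter in the order
   of [pairs]: the next pairing, the exponent of the power of 2, and the
   contribution of the letter to the genus. *)
Definition moves : seq (seq (nat * nat * nat)) :=
 [:: [:: (1, 0, 1); (2, 0, 1); (3, 0, 1); (4, 0, 1)];
    [:: (0, 0, 0); (5, 0, 1); (6, 0, 1); (7, 0, 1)];
    [:: (8, 0, 1); (2, 1, 0); (9, 0, 1); (10, 0, 1)];
    [:: (11, 0, 1); (9, 0, 1); (3, 1, 0); (12, 0, 1)];
    [:: (7, 0, 1); (13, 0, 1); (14, 0, 1); (0, 0, 0)];
    [:: (15, 0, 0); (5, 1, 0); (16, 0, 1); (17, 0, 1)];
    [:: (18, 0, 0); (16, 0, 1); (6, 1, 0); (19, 0, 1)];
    [:: (4, 0, 0); (20, 0, 1); (21, 0, 1); (1, 0, 0)];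
    [:: (2, 0, 0); (2, 0, 0); (21, 0, 1); (21, 0, 1)];
    [:: (22, 0, 1); (9, 1, 0); (9, 1, 0); (22, 0, 1)];
    [:: (21, 0, 1); (2, 0, 0); (21, 0, 1); (2, 0, 0)];
    [:: (3, 0, 0); (20, 0, 1); (3, 0, 0); (20, 0, 1)];
    [:: (20, 0, 1); (20, 0, 1); (3, 0, 0); (3, 0, 0)];
    [:: (19, 0, 1); (13, 1, 0); (16, 0, 1); (18, 0, 0)];
    [:: (17, 0, 1); (16, 0, 1); (14, 1, 0); (15, 0, 0)];
    [:: (5, 0, 1); (5, 0, 1); (14, 0, 1); (14, 0, 1)];
    [:: (23, 0, 0); (16, 1, 0); (16, 1, 0); (23, 0, 0)];
    [:: (14, 0, 0); (5, 0, 0); (14, 0, 0); (5, 0, 0)];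
    [:: (6, 0, 1); (13, 0, 1); (6, 0, 1); (13, 0, 1)];
    [:: (13, 0, 0); (13, 0, 0); (6, 0, 0); (6, 0, 0)];
    [:: (12, 0, 0); (20, 1, 0); (9, 0, 0); (11, 0, 0)];
    [:: (10, 0, 0); (9, 0, 0); (21, 1, 0); (8, 0, 0)];
    [:: (9, 0, 0); (9, 0, 0); (9, 0, 0); (9, 0, 0)];
    [:: (16, 0, 1); (16, 0, 1); (16, 0, 1); (16, 0, 1)]].

Definition loops k := nth 0 nb_loops k.
Definition move k ab := nth (0, 0, 0) (nth [::] moves k) (index ab pairs).
Definition next_pairing k ab := (move k ab).1.1.
Definition weight k ab := (move k ab).1.2.
Definition step k ab := (move k ab).2.

Definition on_chords k (x y : quad) : bool :=
  let: (x1, x2, x3, x4) := x in let: (y1, y2, y3, y4) := y in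
  let z := [:: x1; x2; x3; x4; y1; y2; y3; y4] in
  all (fun p => nth true z p.1 == nth true z p.2) (nth [::] chords k).

Fixpoint gen k (s : seq pair2) : nat :=
  if s is ab :: s' then step k ab + gen (next_pairing k ab) s' else 0.

(** The state once the outer letters are summed out: they leave only the pairing [k] of the inner
    ends [x] and the current outer ends [y]. *)
Definition colourings k (s : seq pair2) : nat :=
  \sum_(x <- quads) \sum_(y <- quads)
    on_chords k x y * count (fun cs => walks x s cs y) (words (size s)).

Lemma count_words_cons n P :
  count P (words n.+1) = \sum_(p <- pairs) count (fun s => P (p :: s)) (words n).
Proof.
rewrite [words _]/= !count_cat !count_map !big_cons big_nil /=.
by rewrite !addn0.
Qed.

(** Lists and [sumn] replace big operators so that the check below evaluates. *)
Definition transfer k ab (x z : quad) : nat :=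
  sumn [seq sumn [seq (on_chords k x y && compat ab uv y &&
                       (inward ab uv y == z) : nat) | uv <- pairs] | y <- quads].

Lemma transfer_check :
  all (fun k => all (fun ab =>
    [&& next_pairing k ab < 24,
        weight k ab + (step k ab).*2 + loops (next_pairing k ab) == (loops k).+1 &
      all (fun x => all (fun z =>
        transfer k ab x z == 2 ^ weight k ab * on_chords (next_pairing k ab) x z)
      quads) quads]) pairs) (iota 0 24).
Proof. by vm_cast_no_check (erefl true). Qed.

Lemma loops_check :
  all (fun k => sumn [seq (on_chords k x x : nat) | x <- quads] == 2 ^ loops k)
    (iota 0 24).
Proof. by vm_cast_no_check (erefl true). Qed.

Lemma moveP k ab : k < 24 ->
  [/\ next_pairing k ab < 24,
      weight k ab + (step k ab).*2 + loops (next_pairing k ab) = (loops k).+1 &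
      forall x z, \sum_(y <- quads) \sum_(uv <- pairs)
          (on_chords k x y && compat ab uv y && (inward ab uv y == z)) =
        2 ^ weight k ab * on_chords (next_pairing k ab) x z].
Proof.
move=> k24; have /(allP transfer_check)/allP/(_ ab (mem_pairs _)) : k \in iota 0 24.
  by rewrite mem_iota.
case/and3P => -> /eqP -> /allP H; split=> // x z.
have /allP/(_ z (mem_quads z))/eqP <- := H x (mem_quads x).
rewrite /transfer sumnE big_map; apply: eq_bigr => y _.
by rewrite sumnE big_map.
Qed.

Lemma colourings_cons k ab s : k < 24 ->
  colourings k (ab :: s) = 2 ^ weight k ab * colourings (next_pairing k ab) s.
Proof.
move=> k24; have [_ _ T] := moveP ab k24.
pose N x y := count (fun cs => walks x s cs y) (words (size s)).
rewrite /colourings big_distrr; apply: eq_bigr => x _ /=.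
(* [z] stands for the ends left after removing the letter; for fixed [z], the sum over [y] and [uv]
   is the local rule [T]. *)
transitivity (\sum_(y <- quads) \sum_(uv <- pairs) \sum_(z <- quads)
   (on_chords k x y && compat ab uv y && (inward ab uv y == z)) * N x z).
  apply: eq_bigr => y _; rewrite count_words_cons big_distrr /=.
  apply: eq_bigr => uv _.
  rewrite (bigD1_seq (inward ab uv y)) ?mem_quads ?uniq_quads //= eqxx andbT.
  rewrite big1 => [|z]; last by rewrite eq_sym => /negbTE->; rewrite andbF.
  rewrite addn0 -mulnb -mulnA; congr (_ * _).
  by case: (compat ab uv y); rewrite ?mul1n // mul0n count_pred0.
rewrite big_distrr /=; under eq_bigr => y _ do rewrite exchange_big.
rewrite exchange_big; apply: eq_bigr => z _ /=.
by rewrite mulnA -T big_distrl; apply: eq_bigr => y _; rewrite big_distrl.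
Qed.

(** The identity in [moveP] balances exponents letter by letter: each new factor 2 is shared between
    the weight, the change in loops, and a factor 4 per unit of genus. *)
Lemma colourings_gen k s : k < 24 ->
  colourings k s * 4 ^ gen k s = 2 ^ (size s + loops k).
Proof.
elim: s k => [|ab s IH] k k24.
  rewrite /= muln1 add0n; have : k \in iota 0 24 by rewrite mem_iota.
  move/(allP loops_check)/eqP <-.
  rewrite sumnE big_map; apply: eq_bigr => x _.
  rewrite (bigD1_seq x) ?mem_quads ?uniq_quads //= eqxx muln1.
  by rewrite big1 ?addn0 // => y /negbTE; rewrite eq_sym => ->; rewrite muln0.
rewrite colourings_cons //= expnD mulnACA.
have [n24 e _] := moveP ab k24; rewrite IH // -(expnM 2 2) -!expnD.
by congr (2 ^ _); rewrite mulnC muln2 !addSn -addnS -e; lia.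
Qed.

(** Pairing 0 forces [x = y], so [colourings 0] is 2^V for V vertices. Hence V + 2 [gen] = n + 4,
    while there are n + 3 edges. *)
Lemma genus_ladder11 n (KT : {set 'I_n} * {set 'I_n}) :
  genus (ladder11 KT) = gen 0 (bits KT).
Proof.
have sb : size (bits KT) = n by rewrite size_map size_rev size_enum_ord.
have V : 2 ^ nb_vertices (ladder11 KT) = colourings 0 (bits KT).
  rewrite card_ladder_colourings /colourings sb; apply: eq_bigr => x _.
  have E y : on_chords 0 x y = (x == y).
    case: x y => [[[x1 x2] x3] x4] [[[y1 y2] y3] y4].
    by rewrite /on_chords /= andbT !xpair_eqE !andbA.
  rewrite (bigD1_seq x) ?mem_quads ?uniq_quads //= E eqxx mul1n.
  by rewrite big1 ?addn0 // => y /negbTE; rewrite E eq_sym => ->.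
have := colourings_gen (bits KT) (isT : 0 < 24).
rewrite -V -(expnM 2 2) -expnD sb => /eqP; rewrite eqn_exp2l // => /eqP.
rewrite /genus nb_edges_ladder11 (_ : loops 0 = 4) // mul2n => e.
by rewrite (_ : _ - _ = (gen 0 (bits KT)).*2) ?doubleK //; lia.
Qed.

Definition gen_count k n i := count (fun s => gen k s == i) (words n).

Lemma genus_count11_gen n i : genus_count11 n i = gen_count 0 n i.
Proof.
rewrite /gen_count -(@card_words ({set 'I_n} * {set 'I_n})%type (@bits n)).
- by apply: eq_card => KT; rewrite !inE genus_ladder11.
- move=> [K T] [K' T'] /eq_in_map e.
  have E k : ((k \in K) = (k \in K')) * ((k \in T) = (k \in T')).
    have kI : k \in rev (enum 'I_n) by rewrite mem_rev mem_enum.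
    by have [-> ->] := e k kI.
  by congr (_, _); apply/setP => k; rewrite E.
- by move=> KT; rewrite size_map size_rev size_enum_ord.
move=> s sn; pose p k := nth (true, true) s (index k (rev (enum 'I_n))).
exists ([set k | (p k).1], [set k | (p k).2]).
apply: (@eq_from_nth _ (true, true)); rewrite size_map size_rev size_enum_ord //.
move=> j ltj; have ltj' : j < size (rev (enum 'I_n)).
  by rewrite size_rev size_enum_ord.
rewrite (nth_map (Ordinal ltj)) // !inE -surjective_pairing /p index_uniq //.
by rewrite rev_uniq enum_uniq.
Qed.

Lemma gen_countS k n i :
  gen_count k n.+1 i = \sum_(ab <- pairs)
    (if step k ab <= i then gen_count (next_pairing k ab) n (i - step k ab) else 0).
Proof.
rewrite /gen_count count_words_cons; apply: eq_bigr => ab _ /=.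
case: leqP => h.
  by apply: eq_count => s; rewrite -{1}(subnKC h) eqn_add2l.
by rewrite -(count_pred0 (words n)); apply: eq_count => s /=; apply/negbTE; lia.
Qed.

(** * Generating polynomials *)

Section GeneratingPolynomials.
Local Open Scope ring_scope.

Definition gen_poly k n : {poly int} := \sum_(s <- words n) 'X^(gen k s).

Lemma coef_gen_poly k n i : (gen_poly k n)`_i = (gen_count k n i)%:R :> int.
Proof.
rewrite /gen_poly coef_sum /gen_count -sum1_count natr_sum [RHS]big_mkcond /=.
by apply: eq_bigr => s _; rewrite coefXn eq_sym; case: (_ == _).
Qed.

Lemma gen_poly0 k : gen_poly k 0 = 1.
Proof. by rewrite /gen_poly big_seq1 expr0. Qed.

Lemma gen_polyS k n : gen_poly k n.+1 =
  \sum_(ab <- pairs) 'X^(step k ab) * gen_poly (next_pairing k ab) n.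
Proof.
rewrite /gen_poly /= !big_cat !big_cons !big_nil /= !mulr_sumr !big_map.
rewrite !addr0 -!addrA.
by congr (_ + (_ + (_ + _))); apply: eq_bigr => s _; rewrite exprD.
Qed.

Fixpoint rec2 (x0 x1 p q : {poly int}) n : {poly int} :=
  if n is n'.+1 then rec2 x1 (p * x1 + q * x0) p q n' else x0.

Lemma rec2S x0 x1 p q n :
  rec2 x0 x1 p q n.+2 = p * rec2 x0 x1 p q n.+1 + q * rec2 x0 x1 p q n.
Proof. by elim: n x0 x1 => [|n IH] x0 x1 //; apply: IH. Qed.

Definition lucas_seq (p : {poly int}) := rec2 0 1 p (8%:R * 'X).

(* The eigenvalues of the automaton are the roots of t^2 - 2t - 8X,
   t^2 - t - 8X, t^2 - 4X, t - 1 and t; [polS], [polR] and [polC] solve the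
   recurrences attached to the first three polynomials.  Pairings with the same
   generating polynomial share one [gp]. *)
Definition polS := lucas_seq 2%:R.
Definition polR := lucas_seq 1.
Definition polC := rec2 1 (1 - 3%:R * 'X) 0 (4%:R * 'X).
(** Partial sums of solutions for t^2 - t - 8X bring in the eigenvalue 1. *)
Definition polE n : {poly int} := 2%:R * \sum_(i < n) (polR i + polR i.+1).

Definition gp5 n := polS n.+1 + 2%:R * 'X * polS n.
Definition gp8 n := polS n.+1 + 2%:R * polS n.
Definition gp12 n := polS n.+1 + 4%:R * 'X * polS n - 2%:R * polS n.
Definition gp6 n := gp5 n + (1 - 'X) * polE n.
Definition gp0 n := 1 - 'X + 'X * gp6 n.
Definition gp2 n := 'X * gp8 n + (1 - 'X) * (polR n + polR n.+1).
Definition gp1 n :=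
  6%:R * 'X^2 * polS n + 6%:R * 'X * (1 - 'X) * polR n + polC n.
Definition gp3 n := if n is m.+1 then 2%:R * gp1 m + 2%:R * 'X * gp6 m else 1.
Definition gp7 n := if n is m.+1 then 4%:R * gp2 m else 1.
Definition gp10 n := if n is m.+1 then 2%:R * 'X * (gp0 m + gp1 m) else 1.
Definition gp11 n := if n is m.+1 then 4%:R * 'X * gp2 m else 1.

(** Indexed by pairings, whereas the subscripts of [gp] number classes: pairing 0, which yields the
    genus distribution, has [gp10]. *)
Definition gen_polys : seq (nat -> {poly int}) :=
  [:: gp10; gp1; gp0; gp0; gp1; gp2; gp2; gp3; gp2; gp5; gp2; gp2;
      gp2; gp2; gp2; gp11; gp8; gp7; gp11; gp7; gp6; gp6; gp8; gp12].

(** The sum telescopes by the recurrence of [polR]; the factor 2X avoids a division. *)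
Lemma polE_R n : 2%:R * 'X * polE n = polR n.+1 + 4%:R * 'X * polR n - 1.
Proof.
rewrite /polE; elim: n => [|n IH].
  by rewrite big_ord0 /polR /lucas_seq /=; ring.
rewrite big_ord_recr /= mulrDr mulrDr IH /polR /lucas_seq rec2S; ring.
Qed.

Lemma polS_rec n : polS n.+2 = 2%:R * polS n.+1 + 8%:R * 'X * polS n.
Proof. exact: rec2S. Qed.

Lemma polR_rec n : polR n.+2 = polR n.+1 + 8%:R * 'X * polR n.
Proof. by rewrite /polR /lucas_seq rec2S mul1r. Qed.

Lemma polC_rec n : polC n.+2 = 4%:R * 'X * polC n.
Proof. by rewrite /polC rec2S mul0r add0r. Qed.

Lemma polE_rec n : polE n.+1 = polE n + 2%:R * (polR n + polR n.+1).
Proof. by rewrite /polE big_ord_recr /= mulrDr. Qed.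

Lemma gp5_rec n : gp5 n.+1 = 2%:R * gp5 n + 2%:R * 'X * gp8 n.
Proof. by rewrite /gp5 /gp8 polS_rec; ring. Qed.

Lemma gp8_rec n : gp8 n.+1 = 4%:R * gp5 n.
Proof. by rewrite /gp5 /gp8 polS_rec; ring. Qed.

(** Pairings 16 and 22 share [gp8] but move differently, so it must satisfy two recurrences. *)
Lemma gp8_rec12 n : gp8 n.+1 = 2%:R * gp8 n + 2%:R * gp12 n.
Proof. by rewrite /gp12 /gp8 polS_rec; ring. Qed.

Lemma gp12_rec n : gp12 n.+1 = 4%:R * 'X * gp8 n.
Proof. by rewrite /gp12 /gp8 polS_rec; ring. Qed.

Lemma gp6_rec n : gp6 n.+1 = 2%:R * gp2 n + gp5 n + gp6 n.
Proof. by rewrite /gp6 /gp2 /gp5 /gp8 polE_rec polS_rec; ring. Qed.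

Lemma gp0_rec n : gp0 n.+1 = gp0 n + 2%:R * 'X * gp2 n + 'X * gp5 n.
Proof. by rewrite /gp0 gp6_rec /gp6; ring. Qed.

Lemma gp2_rec n : gp2 n.+1 = 2%:R * gp0 n + 2%:R * 'X * gp6 n.
Proof.
rewrite /gp2 /gp0 /gp6 /gp5 /gp8 polS_rec polR_rec.
(* The difference of the two sides is a multiple of the relation [polE_R]. *)
apply/eqP; rewrite -subr_eq0; apply/eqP.
transitivity (2%:R * ('X - 1) * (2%:R * 'X * polE n -
  (polR n.+1 + 4%:R * 'X * polR n - 1))); first by ring.
by rewrite polE_R subrr mulr0.
Qed.

Lemma gp2_rec11 n :
  gp2 n.+1 = gp2 n + 'X * gp8 n + 'X * gp7 n + gp11 n.
Proof.
case: n => [|n]; rewrite /gp2 /gp7 /gp11 /gp2 /gp8 ?polS_rec ?polR_rec.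
  by rewrite /polS /polR /=; ring.
by ring.
Qed.

Lemma gp1_rec n : gp1 n.+1 = 'X * gp3 n + 2%:R * 'X * gp2 n + gp10 n.
Proof.
case: n => [|n].
  by rewrite /gp1 /gp3 /gp2 /gp10 /gp8 /polC /polS /polR /=; ring.
rewrite /gp1 /gp3 /gp10 /gp1 /gp0 /gp6 /gp2 /gp8 /gp5 ?polS_rec ?polR_rec ?polC_rec.
apply/eqP; rewrite -subr_eq0; apply/eqP.
transitivity (2%:R * 'X * ('X - 1) * (2%:R * 'X * polE n -
  (polR n.+1 + 4%:R * 'X * polR n - 1))); first by ring.
by rewrite polE_R subrr mulr0.
Qed.

Lemma gen_poly_closed k n : (k < 24)%N -> gen_poly k n = nth gp0 gen_polys k n.
Proof.
elim: n k => [|n IH] k k24.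
  rewrite gen_poly0; do 24?[case: k k24 => [|k] k24; first
    by rewrite /= /gp0 /gp1 /gp2 /gp6 /gp5 /gp8 /gp12 /polE ?big_ord0
               /polS /polR /polC /=; ring].
  by [].
rewrite gen_polyS.
under eq_bigr => ab _ do (rewrite IH; last by case: (moveP ab k24)).
rewrite /next_pairing /step /move !big_cons big_nil.
do 24?[case: k k24 => [|k] k24; first
  by rewrite /= ?(gp0_rec, gp1_rec, gp5_rec, gp6_rec, gp12_rec); (ring ||
    (rewrite gp2_rec; ring) || (rewrite gp2_rec11; ring) ||
    (rewrite gp8_rec; ring) || (rewrite gp8_rec12; ring))].
by [].
Qed.

(** * Coefficients of the generating polynomials *)

Lemma coef_lucas_seq (p n i : nat) :
  (lucas_seq p%:R n.+1)`_i = (p ^ (n - i.*2) * 8 ^ i * 'C(n - i, i))%:R :> int.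
Proof.
(* Two consecutive indices are carried together for the second-order recurrence; the induction step
   is Pascal's rule. *)
suff [] : (forall i, (lucas_seq p%:R n.+1)`_i =
      (p ^ (n - i.*2) * 8 ^ i * 'C(n - i, i))%:R :> int) /\
    (forall i, (lucas_seq p%:R n.+2)`_i =
      (p ^ (n.+1 - i.*2) * 8 ^ i * 'C(n.+1 - i, i))%:R :> int) by [].
elim: n {i} => [|n [IH0 IH1]]; split=> // i.
- by rewrite /lucas_seq /= coef1 !sub0n bin0n; case: i => [|i]; rewrite ?muln0.
- rewrite /lucas_seq /= mulr0 addr0 mulr1 -polyC_natr coefC.
  case: i => [|i]; first by rewrite /= !muln1.
  by rewrite subSS sub0n bin0n muln0.
rewrite [lucas_seq _ _]rec2S -!/(lucas_seq _ _) coefD -(mulrA 8%:R) !mulr_natl.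
rewrite !coefMn coefXM IH1.
case: i => [|i] /=; rewrite ?mul0rn ?addr0 ?IH0 -!mulrnA -?mulrnDr.
  by rewrite !subn0 !bin0 !muln1 mulnC -expnS.
congr (_%:R).
rewrite doubleS !subSS [in RHS]expnS [in LHS]expnS.
move: (8 ^ i)%N => c; have [lin | lt] := leqP i n; last first.
  have -> : (n - i = 0)%N by apply/eqP; rewrite subn_eq0 ltnW.
  have -> : (n.+1 - i = 0)%N by apply/eqP; rewrite subn_eq0.
  by case: i lt => // i _; rewrite !bin0n !muln0.
rewrite subSn // binS mulnDr; congr (_ + _)%N; last first.
  by rewrite -!mulnA; congr (_ * _)%N; rewrite mulnA mulnC.
(* Where the exponent of [p] would be truncated, the binomial coefficient vanishes. *)
have [lt | ge] := ltnP (n - i) i.+1; first by rewrite bin_small // !muln0.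
have -> : (n - i.*2 = (n - i.*2.+1).+1)%N.
  by rewrite -subSn ?subSS // -addnn -ltn_subRL.
by rewrite expnS mulnC !mulnA.
Qed.

Lemma coef_polS n i : (polS n.+1)`_i = (2 ^ (n + i) * 'C(n - i, i))%:R :> int.
Proof.
rewrite coef_lucas_seq; congr (_%:R).
have [lt | ge] := ltnP (n - i) i; first by rewrite bin_small ?muln0.
rewrite -[8%N]/(2 ^ 3)%N -expnM -expnD.
by congr (2 ^ _ * _)%N; rewrite -[i.*2]addnn; lia.
Qed.

Lemma coef_polR n i : (polR n.+1)`_i = (8 ^ i * 'C(n - i, i))%:R :> int.
Proof. by rewrite [LHS](coef_lucas_seq 1) exp1n mul1n. Qed.

Lemma polC_even k : polC k.*2 = (4%:R * 'X) ^+ k.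
Proof.
elim: k => [|k IH]; first by rewrite expr0.
by rewrite doubleS polC_rec IH -exprS.
Qed.

Lemma polC_odd k : polC k.*2.+1 = (4%:R * 'X) ^+ k * (1 - 3%:R * 'X).
Proof.
elim: k => [|k IH]; first by rewrite expr0 mul1r.
by rewrite doubleS polC_rec IH mulrA -exprS.
Qed.

(** Twice the coefficients of [polC], which has at most two monomials. *)
Definition top_term m j : int :=
  if odd m then (2 ^ m * (j == m./2))%:R
  else (2 ^ m.-1 * (j == m./2.-1))%:R - 3%:R * (2 ^ m.-1 * (j == m./2))%:R.

Lemma coef_polC n j : 2%:R * (polC n)`_j = top_term n.+1 j.
Proof.
have exp4 k : (4%:R * 'X : {poly int}) ^+ k = (4 ^ k)%:R *: 'X^k.
  by rewrite exprMn -natrX mulr_natl -scaler_nat.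
have E4 k : (4 ^ k = 2 ^ k.*2)%N by rewrite -(expnM 2 2) mul2n.
rewrite /top_term /=; have [on | en] := boolP (odd n).
  rewrite (_ : n = (n./2).*2.+1); last by have := odd_double_half n; lia.
  move: (n./2) => k; rewrite polC_odd exp4 mulrBr mulr1 coefB.
  have -> (c : int) : (c *: 'X^k : {poly int}) * (3%:R * 'X) =
                      (c *: 'X^(k.+1) : {poly int}) *+ 3.
    by rewrite mulrCA mulr_natl -scalerAl -exprSr.
  rewrite coefMn !coefZ !coefXn.
  rewrite (_ : uphalf k.*2.+1 = k.+1) /= ?expnS ?E4 ?natrM; last by lia.
  ring.
rewrite (_ : n = (n./2).*2); last by have := odd_double_half n; lia.
move: (n./2) => k; rewrite polC_even exp4 coefZ coefXn.
rewrite (_ : (uphalf k.*2 = k)%N); last by lia.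
by rewrite expnS E4 !natrM; ring.
Qed.

(* The division-free form of m / (m - i) * C(m - i, i), valid for m > 1. *)
Definition lucas m i : nat :=
  'C(m - i, i) + (if i is j.+1 then 'C((m - i).-1, j) else 0).

Lemma lucas_bin n i : (0 < n)%N ->
  (lucas n.+1 i)%:R = 2%:R * ('C(n.+1 - i, i))%:R - ('C(n - i, i))%:R :> int.
Proof.
move=> n0; rewrite /lucas; case: i => [|i]; first by rewrite !bin0.
rewrite subSS; have [lt | ge] := ltnP i n; last first.
  have -> : (n - i = 0)%N by apply/eqP; rewrite subn_eq0.
  have -> : (n - i.+1 = 0)%N by apply/eqP; rewrite subn_eq0 ltnW.
  by rewrite !bin0n; case: i ge => [|i] // ; rewrite leqNgt n0.
have -> : (n - i = (n - i.+1).+1)%N by rewrite -subSn.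
by rewrite binS /= !natrD; ring.
Qed.

(** Eliminating [polE] by [polE_R] leaves separate contributions of [polS], [polR] and [polC]; the
    first two combine consecutive terms exactly as in [lucas_bin]. *)
Lemma coef_gp10 n g : (0 < n)%N ->
  (gp10 n.+1)`_g.+2 = (2 ^ (n.+1 + g) * lucas n.+1 g)%:R
    + (8 ^ g.+1 * lucas n.+1 g.+1)%:R - (8 ^ g * lucas n.+1 g)%:R
    - (g == 0%N)%:R + top_term n.+1 g.+1 :> int.
Proof.
move=> n0; have -> : gp10 n.+1 = (2%:R * (polS n.+2 - polS n.+1)) * 'X * 'X
   + (1 - 'X) * (2%:R * polR n.+2 - polR n.+1 + 1) * 'X + (2%:R * polC n) * 'X.
  apply/eqP; rewrite -subr_eq0; apply/eqP.
  rewrite /gp10 /gp0 /gp1 /gp6 /gp5 polS_rec polR_rec.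
  transitivity ('X * (1 - 'X) * (2%:R * 'X * polE n -
    (polR n.+1 + 4%:R * 'X * polR n - 1))); first by ring.
  by rewrite polE_R subrr mulr0.
rewrite !coefD !coefMX /= mulrBl mul1r (mulrC 'X) coefB coefMX /=.
have cB i : (2%:R * polR n.+2 - polR n.+1)`_i = (8 ^ i * lucas n.+1 i)%:R :> int.
  by rewrite coefB mulr_natl coefMn !coef_polR !natrM lucas_bin //; ring.
rewrite !(coefD _ 1) !cB !coef1 /= addr0 !mulr_natl !coefMn -[_ *+ 2]mulr_natl.
rewrite -[X in _ = _ + X]coef_polC; congr (_ + _); last by rewrite mulr_natl.
rewrite coefB !coef_polS addSn !(expnS 2) !natrM !lucas_bin //; ring.
Qed.

Lemma coef_gp10_01 n : (1 < n)%N ->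
  ((gp10 n.+1)`_0 = 0 :> int) /\ ((gp10 n.+1)`_1 = 2%:R :> int).
Proof.
move=> n1; rewrite /gp10 -mulrA mulrCA (mulrC 'X) !coefMX /=; split => //.
rewrite mulr_natl coefMn /gp0 /gp1 !coefD !coef0M coef1 coefN coefX /=.
rewrite ?(mul0r, mulr0, oppr0, addr0, add0r) mulrnDl -[_ *+ 2]mulr_natl.
rewrite -[X in _ + X]mulr_natl coef_polC.
have t0 : top_term n.+1 0 = 0.
  have n2 : (0 < (n.+1)./2)%N by rewrite half_gt0 ltnS ltnW.
  rewrite /top_term; case: ifP => [_|/negbT on].
    by rewrite eq_sym (gtn_eqF n2) muln0.
  have n3 : (0 < ((n.+1)./2).-1)%N by lia.
  rewrite eq_sym (gtn_eqF n3) muln0 sub0r eq_sym (gtn_eqF n2) muln0.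
  by rewrite mulr0 oppr0.
by rewrite t0 addr0 mulr1.
Qed.

End GeneratingPolynomials.

(** * Unimodality *)

(** Monotonicity is asked beyond the extreme genera too, so that these need not be computed. *)
Definition increases_to (f : nat -> nat) p :=
  (forall i, i < p -> f i <= f i.+1) /\ (0 < p) /\ f p.-1 < f p.

Definition decreases_from (f : nat -> nat) p :=
  (forall i, p <= i -> f i.+1 <= f i) /\ f p.+1 < f p.

Lemma is_peak_of_monotone f q r p : increases_to f p -> decreases_from f p ->
  q <= p <= r -> is_peak f q r p.
Proof.
case=> incr [p0 sincr] [decr sdecr] /andP[qp pr]; split.
- by rewrite qp leqnn; split.
- by move=> i _ ip; apply: incr; apply: ltnW.
- by move=> i _ ip; move: sincr; rewrite -ip.
- by move=> i /andP[pi ip]; rewrite (@anti_leq i p) ?pi ?ip.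
by split=> // i /andP[/ltnW pi _]; apply: decr.
Qed.

Lemma genus_bounds n p : 0 < genus_count11 n p ->
  min_genus11 n <= p <= max_genus11 n.
Proof.
case/card_gt0P => KT; rewrite inE => /eqP <-; apply/andP; split.
  by rewrite /min_genus11; case: arg_minnP => // KT' _; apply.
exact: (leq_bigmax KT).
Qed.

(** * Ratios of consecutive Lucas coefficients and the resulting estimates *)

Lemma lucas_mul m i : 1 < m -> i <= m -> (m - i) * lucas m i = m * 'C(m - i, i).
Proof.
rewrite /lucas => m1 im; case: i im => [|i] im; first by rewrite addn0 subn0.
by rewrite mulnDr mul_bin_diag -mulnDl subnK.
Qed.

(** The quotient is (m - 2i)(m - 2i - 1) / ((i + 1)(m - i - 1)); writing m as [i.*2 + e.+2] avoids
    truncated subtraction. *)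
Lemma lucas_ratio i e : 0 < i.*2 + e ->
  i.+1 * (i + e.+1) * lucas (i.*2 + e.+2) i.+1 =
  e.+2 * e.+1 * lucas (i.*2 + e.+2) i.
Proof.
move=> h; set m := i.*2 + e.+2.
have E0 := @lucas_mul m i; have E1 := @lucas_mul m i.+1.
have M0 : m - i = i + e.+2 by rewrite /m; lia.
have M1 : m - i.+1 = i + e.+1 by rewrite /m; lia.
rewrite M0 in E0; rewrite M1 in E1.
have {}E0 : (i + e.+2) * lucas m i = m * 'C(i + e.+2, i) by apply: E0; lia.
have {}E1 : (i + e.+1) * lucas m i.+1 = m * 'C(i + e.+1, i.+1) by apply: E1; lia.
have B1 : i.+1 * 'C(i + e.+1, i.+1) = e.+1 * 'C(i + e.+1, i).
  by rewrite mul_bin_left addKn.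
have B0 : (i + e.+2) * 'C(i + e.+1, i) = e.+2 * 'C(i + e.+2, i).
  by have := mul_bin_down (i + e.+2) i; rewrite addKn addnS /=.
apply/eqP; rewrite -(eqn_pmul2l (_ : 0 < i + e.+2)) ?addnS //; apply/eqP.
move: ('C(i + e.+2, i)) ('C(i + e.+1, i)) ('C(i + e.+1, i.+1)) E0 E1 B0 B1.
move: (lucas m i) (lucas m i.+1) => L0 L1 C0 C' C1 E0 E1 B0 B1.
transitivity (i.+1 * (i + e.+2) * ((i + e.+1) * L1)); first by ring.
rewrite E1; transitivity (m * (i + e.+2) * (i.+1 * C1)); first by ring.
rewrite B1; transitivity (m * e.+1 * ((i + e.+2) * C')); first by ring.
rewrite B0; transitivity (e.+2 * e.+1 * (m * C0)); first by ring.
by rewrite -E0; ring.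
Qed.

(** Here d = m - 2i and A, B, C are k_i, k_(i+1), k_(i+2), so [i < d] means 3i < m. The bound 4 is
    attained at i = d - 1, which places the peak near m/3. *)
Lemma increase_step i d A B C : i < d -> 42 <= i.*2 + d ->
  i.+1 * (i + d.-1) * B = 8 * (d * d.-1) * A ->
  i.+2 * (i + d.-2) * C = 8 * (d.-2 * d.-2.-1) * B ->
  4 * A <= B /\ 2 * B <= C.
Proof.
case: d => [|[|[|e]]] /=; [lia|lia|lia|] => id m42 EB EC; split.
  have D0 : 0 < i.+1 * (i + e.+2) by rewrite addnS.
  rewrite -(leq_pmul2l D0) EB.
  have : i.+1 * (i + e.+2) <= 2 * (e.+3 * e.+2) by nia.
  by nia.
have D0 : 0 < i.+2 * (i + e.+1) by rewrite addnS.
rewrite -(leq_pmul2l D0) EC.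
have : i.+2 * (i + e.+1) <= 4 * (e.+1 * e) by nia.
by nia.
Qed.

Lemma exp2_ge d : 8 <= d -> 32 * d <= 2 ^ d.
Proof.
elim: d => // d IH; rewrite ltnS leq_eqVlt => /predU1P[<- // | h].
by rewrite expnS; have := IH h; lia.
Qed.

(** The ratio of consecutive k_i decreases with i, so once at most 1 it stays so. *)
Lemma decrease_step_small i d A B C : 3 <= d ->
  8 * (d * d.-1) <= i.+1 * (i + d.-1) ->
  i.+1 * (i + d.-1) * B = 8 * (d * d.-1) * A ->
  i.+2 * (i + d.-2) * C = 8 * (d.-2 * d.-2.-1) * B ->
  B <= A /\ C <= B.
Proof.
case: d => [|[|[|e]]] //= _ h EB EC; split.
  have D0 : 0 < i.+1 * (i + e.+2) by rewrite addnS.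
  rewrite -(leq_pmul2l D0) EB.
  by rewrite leq_mul2r h orbT.
have D0 : 0 < i.+2 * (i + e.+1) by rewrite addnS.
rewrite -(leq_pmul2l D0) EC.
rewrite leq_mul2r; apply/orP; right; nia.
Qed.

(** While k_i still grows, the main term 2^(d-2) (4A - B) must absorb the second difference A - 2B +
    C. For [d <= i] the ratio B/A stays below 4 by a margin that the power of 2 amplifies enough. *)
Lemma decrease_step_large i d A B C : 0 < A -> 8 <= d <= i ->
  i.+1 * (i + d.-1) < 8 * (d * d.-1) ->
  i.+1 * (i + d.-1) * B = 8 * (d * d.-1) * A ->
  i.+2 * (i + d.-2) * C = 8 * (d.-2 * d.-2.-1) * B ->
  2 ^ d.-2 * B + C + A < 4 * 2 ^ d.-2 * A + 2 * B.
Proof.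
case: d => [|[|[|e]]] //= A0 /andP[d8 di] h EB EC.
have Q : 32 * e.+3 <= 4 * 2 ^ e.+1 by rewrite -(expnD 2 2); exact: exp2_ge.
move: (2 ^ e.+1) Q => Q HQ.
set D := i.+1 * (i + e.+2) in h EB *; set N := 2 * (e.+3 * e.+2).
have EB' : D * B = 4 * N * A by rewrite EB /N; lia.
have DC : D * C <= 4 * N * B.
  apply: (@leq_trans (i.+2 * (i + e.+1) * C)).
    by rewrite leq_mul2r; apply/orP; right; rewrite /D; nia.
  by rewrite EC leq_mul2r; apply/orP; right; rewrite /N; nia.
have ND : N + 3 * e.+3 <= D + 1 by rewrite /N /D; nia.
have D0 : 0 < D by rewrite /D addnS.
have DN : D < 4 * N by rewrite /N; lia.
have ND' : N <= D by lia.
(* The margin D - N is at least 3d - 1, and 4Q is at least 32d, while D < 8d(d - 1). *)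
have key : 9 * D + 4 * Q * N < 4 * Q * D.
  have h1 : 4 * Q * (3 * e.+3 - 1) <= 4 * Q * (D - N) by rewrite leq_mul2l; lia.
  have h2 : 9 * D < 4 * Q * (3 * e.+3 - 1).
    apply: (@leq_trans (32 * e.+3 * (3 * e.+3 - 1))); last first.
      by rewrite leq_mul2r HQ orbT.
    rewrite (_ : 3 * e.+3 - 1 = 3 * e + 8); last by lia.
    by move: D DN {h EB EB' DC ND D0 ND' h1} => D; rewrite /N; lia.
  have := leq_trans h2 h1; rewrite mulnBr ltn_subRL addnC; exact.
move: D N D0 EB' DC ND' key {EB EC h HQ d8 di ND DN} => D N D0 EB DC ND key.
have DDC : D * D * C <= 16 * (N * N) * A.
  rewrite -mulnA; apply: (@leq_trans (D * (4 * N * B))).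
    by rewrite leq_mul2l DC orbT.
  by rewrite mulnCA EB; apply/eq_leq; ring.
have sq : D * D + 16 * (N * N) <= 9 * (D * D) + 8 * (N * D).
  have h1 : N * N <= N * D by rewrite leq_mul2l ND orbT.
  have h2 : N * D <= D * D by rewrite leq_mul2r ND orbT.
  by lia.
have DD0 : 0 < D * D by rewrite muln_gt0 D0.
(* Multiplying by D^2 clears denominators: B = 4(N/D)A and C is at most 16(N/D)^2 A. *)
rewrite -(ltn_pmul2l DD0).
have -> : D * D * (Q * B + C + A) = D * Q * (D * B) + D * D * C + D * D * A.
  by ring.
have -> : D * D * (4 * Q * A + 2 * B) = D * D * (4 * Q * A) + 2 * D * (D * B).
  by ring.
rewrite EB; have keyDA : (9 * D + 4 * Q * N) * (D * A) < 4 * Q * D * (D * A).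
  by rewrite ltn_pmul2r // muln_gt0 D0.
have sqA : (D * D + 16 * (N * N)) * A <= (9 * (D * D) + 8 * (N * D)) * A.
  by rewrite leq_mul2r sq orbT.
move: (D * D * C) DDC => U; lia.
Qed.

Lemma top_term_low m j : j < m./2.-1 -> top_term m j = 0%R.
Proof.
move=> h; rewrite /top_term.
have -> : (j == m./2) = false by apply/eqP; lia.
have -> : (j == m./2.-1) = false by apply/eqP; lia.
by rewrite !muln0 mulr0 subr0 if_same.
Qed.

Lemma top_term_high m j : m./2 < j -> top_term m j = 0%R.
Proof.
move=> h; rewrite /top_term.
have -> : (j == m./2) = false by apply/eqP; lia.
have -> : (j == m./2.-1) = false by apply/eqP; lia.
by rewrite !muln0 mulr0 subr0 if_same.
Qed.

(** For even m the term jumps by 3 * 2^(m-1) right after j = m/2, hence the side condition. *)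
Lemma top_term_step m j : odd m || (j < m./2) ->
  (top_term m j.+1 <= top_term m j + (2 ^ m)%:R)%R.
Proof.
case: m => [|m]; first by rewrite /top_term /= !muln0.
rewrite /top_term expnS; set P := 2 ^ m.
by case: ifP => [_ _|om jm]; [case: eqP; case: eqP; lia|];
  do 4?case: eqP; lia.
Qed.

Definition lucas8 m i := 8 ^ i * lucas m i.

Lemma genus_countE n g : 0 < n ->
  ((genus_count11 n.+1 g.+2)%:R = (2 ^ (n.+1 + g) * lucas n.+1 g)%:R
    + (lucas8 n.+1 g.+1)%:R - (lucas8 n.+1 g)%:R
    - (g == 0%N)%:R + top_term n.+1 g.+1 :> int)%R.
Proof.
move=> n0; rewrite genus_count11_gen -coef_gen_poly gen_poly_closed //=.
exact: coef_gp10.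
Qed.

Lemma lucas8_ratio i e : 0 < i.*2 + e ->
  i.+1 * (i + e.+1) * lucas8 (i.*2 + e.+2) i.+1 =
  8 * (e.+2 * e.+1) * lucas8 (i.*2 + e.+2) i.
Proof.
move=> h; have := lucas_ratio h; rewrite /lucas8 expnS.
move: (lucas _ i.+1) (lucas _ i) (8 ^ i) => U V P E.
transitivity (8 * P * (i.+1 * (i + e.+1) * U)); first by ring.
by rewrite E; ring.
Qed.

Lemma lucas_gt0 m i : i.*2 <= m -> 0 < lucas m i.
Proof. by move=> h; rewrite /lucas addn_gt0 bin_gt0; apply/orP; left; lia. Qed.

Lemma lucas8_top m i : (m < i.*2) -> 1 < m -> lucas8 m i = 0.
Proof.
move=> h m1; rewrite /lucas8 /lucas bin_small; last by lia.
case: i h => [|i] h; first by lia.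
by rewrite bin_small ?muln0 //; lia.
Qed.

(** * Differences of consecutive counts for m at least 42 *)

Section Large.
Variable m : nat.
Hypothesis m42 : 42 <= m.

(** Since 2^(m+i) L(m, i) = 2^(m-2i) k_i, the main part is 2^d (k_(i+1) - 4 k_i): the ratio 4 is the
    threshold. *)
Lemma count_difference i d : m = i.*2 + d.+2 ->
  ((genus_count11 m i.+3)%:R - (genus_count11 m i.+2)%:R =
  (2 ^ d)%:R * (lucas8 m i.+1)%:R - 4%:R * (2 ^ d)%:R * (lucas8 m i)%:R
  + (lucas8 m i.+2)%:R - 2%:R * (lucas8 m i.+1)%:R + (lucas8 m i)%:R
  + (i == 0%N)%:R + (top_term m i.+2 - top_term m i.+1) :> int)%R.
Proof.
move=> mE; case: m m42 mE => // n n42 mE.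
rewrite !genus_countE; try by lia.
have e8 j : 8 ^ j = 2 ^ (3 * j) by rewrite -(expnM 2 3).
have -> : 2 ^ (n.+1 + i.+1) * lucas n.+1 i.+1 = 2 ^ d * lucas8 n.+1 i.+1.
  by rewrite /lucas8 mulnA e8 -expnD; congr (2 ^ _ * _); lia.
have -> : 2 ^ (n.+1 + i) * lucas n.+1 i = 4 * 2 ^ d * lucas8 n.+1 i.
  by rewrite /lucas8 mulnA e8 -(expnD 2 2) -expnD; congr (2 ^ _ * _); lia.
by rewrite !natrM /=; ring.
Qed.

Lemma count_increases i : 3 * i < m ->
  genus_count11 m i.+2 < genus_count11 m i.+3.
Proof.
move=> im; have mE : m = i.*2 + (m - i.*2 - 2).+2 by lia.
move: (m - i.*2 - 2) mE => d mE; have := count_difference mE.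
rewrite !top_term_low; try by lia.
have [k4 k2] :
    4 * lucas8 m i <= lucas8 m i.+1 /\ 2 * lucas8 m i.+1 <= lucas8 m i.+2.
  apply: (@increase_step i d.+2); try by lia.
    by rewrite /= mE lucas8_ratio //; lia.
  case: d mE => [|[|d]] mE; try by lia.
  have -> : m = i.+1.*2 + d.+2 by lia.
  by rewrite /= -addSnnS lucas8_ratio //; lia.
have kp : 0 < lucas8 m i by rewrite muln_gt0 expn_gt0 lucas_gt0 //; lia.
have : 4 * 2 ^ d * lucas8 m i <= 2 ^ d * lucas8 m i.+1.
  by rewrite [4 * _]mulnC -mulnA leq_mul2l k4 orbT.
move: (2 ^ d) => Q; rewrite -!natrM !natz; lia.
Qed.

(** If k_i no longer grows, 2^(d+1) k_i outweighs the possible jump 2^m of [top_term]. Otherwise i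
    is far enough from m/2 for [top_term] to vanish, and [decrease_step_large] applies. *)
Lemma count_decreases i : i.*2 + 2 < m <= 3 * i ->
  genus_count11 m i.+3 < genus_count11 m i.+2.
Proof.
case/andP => im mi; have mE : m = i.*2 + (m - i.*2 - 2).+2 by lia.
move: (m - i.*2 - 2) mE => d mE; have := count_difference mE.
rewrite (_ : (i == 0) = false); last by lia.
have EB : i.+1 * (i + d.+1) * lucas8 m i.+1 = 8 * (d.+2 * d.+1) * lucas8 m i.
  by rewrite mE lucas8_ratio //; lia.
have EC : i.+2 * (i + d) * lucas8 m i.+2 = 8 * (d * d.-1) * lucas8 m i.+1.
  case: d mE {EB} => [|[|d]] mE; [by lia | | ].
    by rewrite (@lucas8_top _ i.+2) ?muln0 ?mul0n //; lia.
  have -> : m = i.+1.*2 + d.+2 by lia.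
  by rewrite /= -addSnnS lucas8_ratio //; lia.
have kp : 0 < lucas8 m i by rewrite muln_gt0 expn_gt0 lucas_gt0 //; lia.
have [small | large] := leqP (8 * (d.+2 * d.+1)) (i.+1 * (i + d.+1)).
  have d3 : 3 <= d.+2 by lia.
  have [BA CB] := decrease_step_small d3 small EB EC.
  have top : (top_term m i.+2 <= top_term m i.+1 + (2 ^ m)%:R)%R.
    by apply: top_term_step; lia.
  have big : 2 ^ m < 2 * 2 ^ d * lucas8 m i.
    apply: (@leq_trans (2 * 2 ^ d * 8 ^ i)); last first.
      by rewrite leq_mul2l leq_pmulr ?orbT // lucas_gt0 //; lia.
    rewrite -[8]/(2 ^ 3) -expnM -expnS -expnD ltn_exp2l //; lia.
  have QB : 2 ^ d * lucas8 m i.+1 <= 2 ^ d * lucas8 m i.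
    by rewrite leq_mul2l BA orbT.
  have Q0 : 0 < 2 ^ d by rewrite expn_gt0.
  have QA : lucas8 m i <= 2 ^ d * lucas8 m i by rewrite leq_pmull.
  move: top big; move: (2 ^ m) (2 ^ d) QB QA {Q0} => M Q QB QA top big.
  by rewrite -!natrM; lia.
(* For d at most 5, m >= 42 gives i >= 18, and the ratio would be below 1. *)
have d6 : 6 <= d by rewrite leqNgt; apply/negP => d6; nia.
have di : 8 <= d.+2 <= i by lia.
have := decrease_step_large kp di large EB EC.
rewrite !top_term_low; try by lia.
by rewrite /=; move: (2 ^ d) => Q; rewrite -!natrM; lia.
Qed.

(** At m = 2(i + 1) the two terms in k_(i+1) cancel; beyond that all Lucas coefficients involved are
    zero. *)
Lemma count_vanishes i : m <= i.*2 + 2 -> genus_count11 m i.+3 = 0.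
Proof.
move=> im; have mE : m = m.-1.+1 by lia.
have := @genus_countE m.-1 i.+1; rewrite -mE top_term_high; last by lia.
rewrite (@lucas8_top _ i.+2); try by lia.
have [->| lt] : m = i.+1.*2 \/ m < i.+1.*2 by lia.
  have -> : 2 ^ (i.+1.*2 + i.+1) * lucas i.+1.*2 i.+1 = lucas8 i.+1.*2 i.+1.
    by rewrite /lucas8 -[8]/(2 ^ 3) -expnM; congr (2 ^ _ * _); lia.
  lia.
have k0 : lucas8 m i.+1 = 0 by rewrite lucas8_top //; lia.
have -> : lucas m i.+1 = 0.
  by apply/eqP; move/eqP: k0; rewrite muln_eq0 expn_eq0.
rewrite k0 muln0; lia.
Qed.

Lemma count_start :
  [/\ genus_count11 m 0 = 0, genus_count11 m 1 = 2 & 2 <= genus_count11 m 2].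
Proof.
have mE : m = m.-1.+1 by lia.
have := @genus_countE m.-1 0; rewrite -mE top_term_low; last by lia.
have [|c0 c1] := @coef_gp10_01 m.-1; first by lia.
move: c0 c1; rewrite -mE -[gp10 m](@gen_poly_closed 0 m) // !coef_gen_poly.
rewrite -!genus_count11_gen.
rewrite addn0 /lucas8 expn0 expn1 !mul1n => c0 c1 c2.
have l0 : lucas m 0 = 1 by rewrite /lucas bin0.
have l1 : 0 < lucas m 1 by rewrite lucas_gt0 //; lia.
have P : 3 <= 2 ^ m by apply: (@leq_trans (2 ^ 2)); rewrite ?leq_exp2l //; lia.
move: (2 ^ m) P c2 => P P3 c2; rewrite l0 in c2.
by split; lia.
Qed.

Lemma increases_large : increases_to (genus_count11 m) (p11 m).
Proof.
have [c0 c1 c2] := count_start.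
have pE : p11 m = (m + 2) %/ 3 + 2.
  by rewrite /p11 !ifF //; apply/negbTE; lia.
split=> [[|[|i]] ip|].
- by rewrite c0.
- by rewrite c1.
- by apply/ltnW/count_increases; lia.
split; first by lia.
(* The last i with 3i < m is [((m + 2) %/ 3).-1]. *)
have -> : p11 m = ((m + 2) %/ 3).-1.+3 by lia.
by apply: count_increases; lia.
Qed.

Lemma decreases_large : decreases_from (genus_count11 m) (p11 m).
Proof.
have pE : p11 m = (m + 2) %/ 3 + 2.
  by rewrite /p11 !ifF //; apply/negbTE; lia.
split=> [i ip|]; last first.
  by rewrite pE addn2; apply: count_decreases; lia.
have -> : i = (i - 2).+2 by lia.
have [le | gt] := leqP m ((i - 2).*2 + 2); first by rewrite count_vanishes.
by apply/ltnW/count_decreases; lia.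
Qed.

End Large.

(** * Small n by evaluating the automaton *)

Module N := BinNat.N.

Fixpoint add_rows (s t : seq N.t) : seq N.t :=
  match s, t with
  | x :: s', y :: t' => N.add x y :: add_rows s' t'
  | [::], _ => t
  | _, [::] => s
  end.

Lemma nth_add_rows s t i :
  nth N.zero (add_rows s t) i = N.add (nth N.zero s i) (nth N.zero t i).
Proof.
by elim: s t i => [|x s IH] [|y t] [|i] //=; rewrite ?nth_nil ?N.add_0_r.
Qed.

(** All 24 rows advance together, instead of enumerating 4^n words, and binary numbers hold the
    large counts. *)
Fixpoint gen_table n : seq (seq N.t) :=
  if n is n'.+1 then
    let t := gen_table n' in
    [seq foldr (fun ab => add_rows
             (ncons (step k ab) N.zero (nth [::] t (next_pairing k ab)))) [::] pairs
    | k <- iota 0 24]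
  else nseq 24 [:: N.one].

Lemma gen_tableP n k i : k < 24 ->
  nth N.zero (nth [::] (gen_table n) k) i = N.of_nat (gen_count k n i).
Proof.
elim: n k i => [|n IH] k i k24.
  rewrite /gen_table nth_nseq k24 /gen_count /=.
  by case: i => [|i] //=; rewrite nth_nil.
have add x y : N.of_nat (x + y) = N.add (N.of_nat x) (N.of_nat y) by lia.
have H ab : nth N.zero (ncons (step k ab) N.zero
                          (nth [::] (gen_table n) (next_pairing k ab))) i =
    N.of_nat (if step k ab <= i then gen_count (next_pairing k ab) n (i - step k ab)
              else 0).
  rewrite nth_ncons ltnNge; case: leqP => //= _.
  by rewrite IH //; case: (moveP ab k24).
have S : gen_table n.+1 = [seq foldr (fun ab => add_rows (ncons (step j ab) N.zero
    (nth [::] (gen_table n) (next_pairing j ab)))) [::] pairs | j <- iota 0 24].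
  by [].
rewrite {}S (nth_map 0) ?size_iota // nth_iota // add0n.
rewrite gen_countS; elim: pairs => [|ab l IHl] /=; first by rewrite big_nil nth_nil.
by rewrite big_cons nth_add_rows H IHl add.
Qed.

(** Finitely many indices suffice: past the end of the row both values are the default zero. *)
Definition check_peak (l : seq N.t) p : bool :=
  [&& 0 < p, N.ltb (nth N.zero l p.-1) (nth N.zero l p),
      N.ltb (nth N.zero l p.+1) (nth N.zero l p) &
    all (fun i => N.leb (nth N.zero l (if i < p then i else i.+1))
                        (nth N.zero l (if i < p then i.+1 else i)))
        (iota 0 (maxn p (size l)))].

Lemma check_peakP l p (f : nat -> nat) :
  (forall i, nth N.zero l i = N.of_nat (f i)) -> check_peak l p ->
  increases_to f p /\ decreases_from f p.
Proof.
move=> lf; rewrite /check_peak !lf => /and4P[p0 /N.ltb_spec0 a /N.ltb_spec0 b c].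
have H i : (if i < p then f i <= f i.+1 else f i.+1 <= f i).
  have [li | il] := ltnP i (maxn p (size l)).
    have := allP c i; rewrite mem_iota add0n li => /(_ isT).
    by case: ifP => _; rewrite !lf => /N.leb_spec0; lia.
  move: il; rewrite geq_max => /andP[pi li]; rewrite ltnNge pi /=.
  by have := lf i.+1; rewrite nth_default /N.zero; lia.
split; split.
- by move=> i ip; have := H i; rewrite ip.
- by split=> //; lia.
- by move=> i ip; have := H i; rewrite ltnNge ip.
by lia.
Qed.

(** The range is 2 to 41, complementary to the estimates. *)
Lemma small_check :
  all (fun n => check_peak (nth [::] (gen_table n) 0) (p11 n)) (iota 2 40).
Proof. by vm_cast_no_check (erefl true). Qed.

Theorem corollary3p17 : forall n : nat, 2 <= n ->
  unimodal (@genus_count11 n) (min_genus11 n) (max_genus11 n) /\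
  is_peak (@genus_count11 n) (min_genus11 n) (max_genus11 n) (p11 n).
Proof.
move=> n n2; suff [incr decr] : increases_to (@genus_count11 n) (p11 n) /\
    decreases_from (@genus_count11 n) (p11 n).
  have P : is_peak (@genus_count11 n) (min_genus11 n) (max_genus11 n) (p11 n).
    apply: is_peak_of_monotone => //; apply: genus_bounds.
    (* The strict increase into the peak makes its count positive, so this genus occurs. *)
    by case: incr => _ [_ lt]; apply: leq_ltn_trans lt.
  by split=> //; exists (p11 n), (p11 n).
have [n42 | n42] := leqP 42 n.
  by split; [apply: increases_large | apply: decreases_large].
apply: (@check_peakP (nth [::] (gen_table n) 0)).
  by move=> i; rewrite gen_tableP // genus_count11_gen.
by apply: (allP small_check); rewrite mem_iota; lia.
Qed.
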